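(* Let $\vec t=(t_1,t_2,\ldots)$ be a sequence of convergent type such that the infinite product $\prod_{i=1}^\infty(1+t_i)$ converges to a finite nonzero value, let $\vec c$ be any sequence of positive reals, and let $x_k=c_k(1+t_{k-1})$, $y_k=c_kc_{k+1}t_k$ ($k\ge1$, $t_0=0$). Let $M_n(w)=\dim(w)\,s_w(\vec x\mid\vec y)/(x_1\cdots x_n)$, $w\in\mathbb{YF}_n$, be the clone coherent measures. Then, as $n\to\infty$, the random word $w\in\mathbb{YF}_n$ distributed according to $M_n$ converges in law to a random element of the countable set $1^\infty\mathbb{YF}=\{1^\infty\}\cup\{1^\infty2u:u\in\mathbb{YF}\}$ with distribution $\mu_{\mathrm I}$; that is, $$\lim_{n\to\infty}M_n(1^n)=\mu_{\mathrm I}(1^\infty),\qquad \lim_{n\to\infty}M_{n+|u|+2}(1^n2u)=\mu_{\mathrm I}(1^\infty2u)\quad\text{for every }u\in\mathbb{YF},$$ where $$\mu_{\mathrm I}(1^\infty)=\prod_{i=1}^\infty(1+t_i)^{-1},\qquad \mu_{\mathrm I}(1^\infty2u)=\Bigl(\prod_{i=1}^{|u|-1}(1+t_i)\Bigr)(|u|+1)\,M_{|u|}(u)\,\frac{B_\infty(|u|)}{\prod_{i=1}^\infty(1+t_i)},$$ and $\mu_{\mathrm I}$ is a probability measure on $1^\infty\mathbb{YF}$, i.e. $\mu_{\mathrm I}(1^\infty)+\sum_{u\in\mathbb{YF}}\mu_{\mathrm I}(1^\infty2u)=1$.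
   Context: A Fibonacci word is a finite (possibly empty) word in the letters $1,2$; its weight $|w|$ is the sum of its letters; $\mathbb{YF}_n$ is the set of Fibonacci words of weight $n$ and $\mathbb{YF}=\bigcup_n\mathbb{YF}_n$. $\dim$ is defined by $\dim(\varnothing)=1$, $\dim(1v)=\dim(v)$, $\dim(2v)=(|v|+1)\dim(v)$. For sequences $\vec x,\vec y$: $A_\ell$ ($A_0=1$) is the determinant of the $\ell\times\ell$ tridiagonal matrix with diagonal $x_1,\ldots,x_\ell$, superdiagonal $y_1,\ldots,y_{\ell-1}$ and subdiagonal entries $1$; $B_k(m)$ is the determinant of the $(k+1)\times(k+1)$ tridiagonal matrix with diagonal $y_{m+1},x_{m+3},\ldots,x_{m+k+2}$, superdiagonal $x_{m+1}y_{m+2},y_{m+3},\ldots,y_{m+k+1}$, subdiagonal entries $1$. Clone Schur functions: $s_{1^k}=A_k$, $s_{1^k2u}=B_k(|u|)\,s_u$. For a positive sequence $\vec t$ (with $t_0=0$) put $A_\infty(m)=1+\sum_{r\ge1}t_mt_{m+1}\cdots t_{m+r-1}$ and $B_\infty(m)=t_{m+1}+(t_{m+1}-t_m-1)\,t_{m+2}\,A_\infty(m+3)$, $m\ge0$. The sequence is of convergent type if all series $A_\infty(m)$ converge and $B_\infty(m)\ge0$ for all $m\ge0$; in this case all $s_w(\vec x\mid\vec y)$ are positive and each $M_n$ is a probability measure. Empty products equal $1$. *)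

(* Defs.v *)
From HB Require Import structures.
From mathcomp Require Import all_boot all_order all_algebra.
From mathcomp Require Import all_classical all_reals all_analysis.
Set Implicit Arguments.
Unset Strict Implicit.
Unset Printing Implicit Defensive.
Import Order.TTheory GRing.Theory Num.Theory.
Import numFieldNormedType.Exports.
Local Open Scope classical_set_scope.
Local Open Scope ring_scope.

(* Sequences x_1, x_2, ... are functions nat -> R read at positive indices;
   their value at 0 is irrelevant, except for t, where t 0 = 0 is required. *)

Inductive letter := One | Two.

Definition bool_of_letter (a : letter) : bool :=
  match a with One => false | Two => true end.
Definition letter_of_bool (b : bool) : letter := if b then Two else One.
Lemma bool_of_letterK : cancel bool_of_letter letter_of_bool.
Proof. by case. Qed.
HB.instance Definition _ := Countable.copy letter (can_type bool_of_letterK).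

Definition letter_val (a : letter) : nat :=
  match a with One => 1 | Two => 2 end%N.

Definition fibword := seq letter.

Definition weight (w : fibword) : nat := (\sum_(a <- w) letter_val a)%N.

Fixpoint fdim (w : fibword) : nat :=
  match w with
  | [::] => 1%N
  | One :: v => fdim v
  | Two :: v => ((weight v).+1 * fdim v)%N
  end.

Section CloneSchur.
Variable R : realType.
Implicit Types x y t c u d : nat -> R.

(* d and u are indexed from 0, like the rows and columns. *)
Definition tridiag (l : nat) d u : 'M[R]_l :=
  \matrix_(i < l, j < l)
    if j == i :> nat then d i
    else if j == i.+1 :> nat then u i
    else if i == j.+1 :> nat then 1
    else 0.

Definition Adet x y (l : nat) : R :=
  \det (tridiag l (fun i => x i.+1) (fun i => y i.+1)).

Definition Bdet x y (k m : nat) : R :=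
  \det (tridiag k.+1
    (fun i => if i == 0%N then y m.+1 else x (m + i + 2)%N)
    (fun i => if i == 0%N then x m.+1 * y m.+2 else y (m + i + 2)%N)).

(* clone_schur_aux x y k w is the clone Schur function of 1^k w. *)
Fixpoint clone_schur_aux x y (k : nat) (w : fibword) : R :=
  match w with
  | [::] => Adet x y k
  | One :: v => clone_schur_aux x y k.+1 v
  | Two :: v => Bdet x y k (weight v) * clone_schur_aux x y 0 v
  end.

Definition clone_schur x y (w : fibword) : R := clone_schur_aux x y 0 w.

(* Meant for weight w = n. *)
Definition clone_measure x y (n : nat) (w : fibword) : R :=
  (fdim w)%:R * clone_schur x y w / \prod_(1 <= k < n.+1) x k.

(* The series of A_oo(m) starts at r = 1, so its terms are shifted by one. *)
Definition Ainf_term t (m r : nat) : R := \prod_(m <= i < m + r.+1) t i.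

Definition Ainf t (m : nat) : R := 1 + limn (series (Ainf_term t m)).

Definition Binf t (m : nat) : R :=
  t m.+1 + (t m.+1 - t m - 1) * t m.+2 * Ainf t (m + 3)%N.

Definition convergent_type t : Prop :=
  [/\ t 0%N = 0,
      forall k, (1 <= k)%N -> 0 < t k,
      forall m, cvgn (series (Ainf_term t m))
    & forall m, 0 <= Binf t m].

Definition partial_prod u (n : nat) : R := \prod_(1 <= i < n.+1) u i.

Definition infprod u : R := limn (partial_prod u).

Definition xseq t c (k : nat) : R := c k * (1 + t k.-1).
Definition yseq t c (k : nat) : R := c k * c k.+1 * t k.

(* OneInf is 1^oo and OneInfTwo v is 1^oo 2 v. *)
Inductive infword := OneInf | OneInfTwo of fibword.

Definition muI t x y (z : infword) : R :=
  match z with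
  | OneInf => infprod (fun i => (1 + t i)^-1)
  | OneInfTwo v =>
      (\prod_(1 <= i < weight v) (1 + t i)) * (weight v).+1%:R
      * clone_measure x y (weight v) v
      * (Binf t (weight v) / infprod (fun i => 1 + t i))
  end.

End CloneSchur.

(* Main.v *)
(* Both A_l and B_k(m) satisfy three-term recurrences, which give A_l = c_1 ... c_l and
   B_k(m) = c_(m+1) ... c_(m+k+2) b_k(m) with b_k(m) -> B_oo(m); this yields the two limits.
   Let P_m = prod_(1 <= i < m) (1 + t_i) and let F satisfy F_m = t_m (1 + F_(m+1)).  Then
     sum_(m < N) (m+1) P_m (F_(m+1) - (1 + t_m) F_(m+2))
       = P_N (1 + F_N) - 1 - N P_N F_(N+1)
   telescopes.  For F_m = t_m + ... + t_m ... t_(n-1) the difference on the left is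
   b_(n-m-2)(m), and the identity says that M_n has total mass 1.  For
   F_m = A_oo(m) - 1 it is B_oo(m), and letting N -> oo gives the total mass of mu_I.
   No mass is lost in the limit: H_N = P_N F_(N+1) is nonincreasing because
   B_oo >= 0, and summable, so N H_N -> 0. *)

Require Import Defs.
From mathcomp Require Import all_boot all_order all_algebra.
From mathcomp Require Import all_classical all_reals all_analysis.
From mathcomp Require Import zify ring.
Set Implicit Arguments.
Unset Strict Implicit.
Unset Printing Implicit Defensive.
Import Order.TTheory GRing.Theory Num.Theory.
Import numFieldNormedType.Exports.
Local Open Scope classical_set_scope.
Local Open Scope ring_scope.

(** * Three-term recurrences for tridiagonal determinants *)

Lemma det_tridiag0 (R : realType) (d u : nat -> R) :
  \det (tridiag 0 d u) = 1.
Proof. exact: det_mx00. Qed.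

Lemma det_tridiag1 (R : realType) (d u : nat -> R) :
  \det (tridiag 1 d u) = d 0%N.
Proof. by rewrite det_mx11 !mxE. Qed.

Lemma det_tridiagSS (R : realType) (l : nat) (d u : nat -> R) :
  \det (tridiag l.+2 d u) =
  d l.+1 * \det (tridiag l.+1 d u) - u l * \det (tridiag l d u).
Proof.
rewrite (expand_det_col _ ord_max) !big_ord_recr /= big1 ?add0r; last first.
  move=> i _; rewrite !mxE /=; have := ltn_ord i => ltil.
  rewrite !ifF ?mul0r //; apply/negbTE/eqP; lia.
rewrite /cofactor !mxE /= eqxx ifF ?eqxx; last by apply/negbTE/eqP; lia.
have -> : row' ord_max (col' ord_max (tridiag l.+2 d u)) = tridiag l.+1 d u.
  by apply/matrixP => i j; rewrite !mxE !lift_max.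
set D := \det (tridiag l.+1 d u).
(* The minor left by the entry [u l] ends in a row whose only nonzero entry is the subdiagonal 1, so
   one more expansion reduces it to size [l]. *)
rewrite addrC (expand_det_row _ ord_max) big_ord_recr /= big1 ?add0r; last first.
  move=> i _; rewrite !mxE /= /bump; have := ltn_ord i => ltil.
  rewrite leqnn add1n; have -> : (l < i)%N = false by lia.
  by rewrite add0n !ifF ?mul0r //; apply/negbTE/eqP; lia.
rewrite /cofactor !mxE /= /bump /= leqnn ltnn add1n add0n.
have -> : (l == l.+1) = false by lia.
have -> : (l == l.+2) = false by lia.
rewrite eqxx mul1r.
set A := (X in \det X).
have -> : A = tridiag l d u.
  apply/matrixP => i j; rewrite !mxE /= /bump.
  have := ltn_ord i; have := ltn_ord j => ltjl ltil.
  have -> : (l <= i)%N = false by lia.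
  have -> : (l <= j)%N = false by lia.
  rewrite !add0n.
  have -> : (l <= i)%N = false by lia.
  by have -> : (l < j)%N = false by lia.
have sgn k : (-1) ^+ (k + k) = 1 :> R by rewrite addnn -mul2n exprM sqrrN !expr1n.
by rewrite !sgn mul1r addnS exprS !sgn; ring.
Qed.

Lemma AdetSS (R : realType) (x y : nat -> R) (l : nat) :
  Adet x y l.+2 = x l.+2 * Adet x y l.+1 - y l.+1 * Adet x y l.
Proof. exact: det_tridiagSS. Qed.

Lemma BdetSS (R : realType) (x y : nat -> R) (k m : nat) :
  Bdet x y k.+2 m =
  x (m + k + 4)%N * Bdet x y k.+1 m - y (m + k + 3)%N * Bdet x y k m.
Proof.
by rewrite /Bdet det_tridiagSS /= !addnS !addn0.
Qed.

(** * Closed forms of the determinants for [xseq] and [yseq] *)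

Lemma Adet_xyseq (R : realType) (t c : nat -> R) (l : nat) : t 0%N = 0 ->
  Adet (xseq t c) (yseq t c) l = \prod_(1 <= i < l.+1) c i.
Proof.
move=> t0.
have cE k : \prod_(1 <= i < k.+2) c i = \prod_(1 <= i < k.+1) c i * c k.+1.
  by rewrite big_nat_recr.
suff [] : Adet (xseq t c) (yseq t c) l = \prod_(1 <= i < l.+1) c i /\
   Adet (xseq t c) (yseq t c) l.+1 = \prod_(1 <= i < l.+2) c i by [].
elim: l => [|l [IHl IHl1]].
  by rewrite /Adet det_tridiag0 det_tridiag1 big_geq // big_nat1 /xseq t0 addr0 mulr1.
(* Since A_(l+1) = c_(l+1) A_l by induction, the two terms containing [t l.+1] cancel. *)
by split=> //; rewrite AdetSS IHl IHl1 !cE /xseq /yseq /=; ring.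
Qed.

(* The b_k(m) of the header, written so as to converge visibly to [Binf t m] and to match
   [telescope_tprod]. *)
Definition Btrunc (R : realType) (t : nat -> R) (m k : nat) : R :=
  series (Ainf_term t m.+1) k.+1 - (1 + t m) * series (Ainf_term t m.+2) k.

Lemma Ainf_term_recr (R : realType) (t : nat -> R) (m r : nat) :
  Ainf_term t m r.+1 = Ainf_term t m r * t (m + r).+1.
Proof. by rewrite /Ainf_term addnS big_nat_recr /=; [rewrite addnS | lia]. Qed.

Lemma Ainf_term_recl (R : realType) (t : nat -> R) (m r : nat) :
  Ainf_term t m r.+1 = t m * Ainf_term t m.+1 r.
Proof.
by rewrite /Ainf_term big_ltn; [rewrite addSnnS | lia].
Qed.

Lemma Ainf_term0 (R : realType) (t : nat -> R) (m : nat) : Ainf_term t m 0 = t m.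
Proof. by rewrite /Ainf_term addn1 big_nat1. Qed.

Lemma BtruncS (R : realType) (t : nat -> R) (m k : nat) :
  Btrunc t m k.+1 - Btrunc t m k = (t m.+1 - t m - 1) * Ainf_term t m.+2 k.
Proof.
rewrite /Btrunc !seriesSr Ainf_term_recl; ring.
Qed.

(** Rearranged, this is b_(k+2) = (1 + t_(m+k+3)) b_(k+1) - t_(m+k+3) b_k, which is what [BdetSS]
    becomes once the factors c_i are divided out. *)
Lemma BtruncSS (R : realType) (t : nat -> R) (m k : nat) :
  Btrunc t m k.+2 - Btrunc t m k.+1 =
  t (m + k + 3)%N * (Btrunc t m k.+1 - Btrunc t m k).
Proof.
rewrite !BtruncS Ainf_term_recr.
have -> : (m.+2 + k).+1 = (m + k + 3)%N by lia.
ring.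
Qed.

Lemma Bdet_xyseq (R : realType) (t c : nat -> R) (k m : nat) :
  Bdet (xseq t c) (yseq t c) k m =
  \prod_(m.+1 <= i < m + k + 3) c i * Btrunc t m k.
Proof.
have cE k' : \prod_(m.+1 <= i < m + k'.+1 + 3) c i =
    \prod_(m.+1 <= i < m + k' + 3) c i * c (m + k' + 3)%N.
  have -> : (m + k'.+1 + 3 = (m + k' + 3).+1)%N by lia.
  rewrite big_nat_recr //=; lia.
suff [] : Bdet (xseq t c) (yseq t c) k m =
    \prod_(m.+1 <= i < m + k + 3) c i * Btrunc t m k /\
    Bdet (xseq t c) (yseq t c) k.+1 m =
    \prod_(m.+1 <= i < m + k.+1 + 3) c i * Btrunc t m k.+1 by [].
elim: k => [|k [IHk IHk1]].
  have B0 : Btrunc t m 0 = t m.+1.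
    by rewrite /Btrunc /series /= big_nat1 big_geq // Ainf_term0 mulr0 subr0.
  have B1 : Btrunc t m 1 = t m.+1 + (t m.+1 - t m - 1) * t m.+2.
    by have := BtruncS t m 0; rewrite Ainf_term0 B0 => <-; ring.
  have c0 : \prod_(m.+1 <= i < m + 0 + 3) c i = c m.+1 * c m.+2.
    by rewrite addn0 addn3 big_nat_recr //= big_nat1.
  rewrite cE c0 B1 B0 /Bdet det_tridiagSS det_tridiag1 det_tridiag0 /=.
  rewrite /xseq /yseq /= !addnS !addn0 /=; split; ring.
split=> //; rewrite BdetSS IHk IHk1 !cE.
have -> : Btrunc t m k.+2 = (1 + t (m + k + 3)%N) * Btrunc t m k.+1 -
    t (m + k + 3)%N * Btrunc t m k.
  by have := BtruncSS t m k => h; rewrite -[LHS](subrK (Btrunc t m k.+1)) h; ring.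
rewrite /xseq /yseq addnS addn3 /= !addnS !addn0; ring.
Qed.

(** * The telescoping identity *)

Lemma series_Ainf_termS (R : realType) (t : nat -> R) (m k : nat) :
  series (Ainf_term t m) k.+1 = t m * (1 + series (Ainf_term t m.+1) k).
Proof.
rewrite /series /= big_nat_recl //= Ainf_term0 mulrDr mulr1 mulr_sumr.
by congr (_ + _); apply: eq_bigr => r _; rewrite Ainf_term_recl.
Qed.

(** The P_m of the header. The factor at [m] is excluded, so P_0 = P_1 = 1 and [partial_prod] at [n]
    is P_(n+1). *)
Definition tprod (R : realType) (t : nat -> R) (m : nat) : R :=
  \prod_(1 <= i < m) (1 + t i).

Lemma tprod0 (R : realType) (t : nat -> R) : tprod t 0 = 1.
Proof. by rewrite /tprod big_geq. Qed.

Lemma tprodS (R : realType) (t : nat -> R) (m : nat) : t 0%N = 0 ->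
  tprod t m.+1 = (1 + t m) * tprod t m.
Proof.
move=> t0; case: m => [|m]; first by rewrite tprod0 /tprod big_geq // t0 addr0 mulr1.
by rewrite mulrC /tprod big_nat_recr.
Qed.

(** By the recursion for F, each summand is P_(m+1) (1 + F_(m+1)) - P_m (1 + F_m). The recursion is
    asked only below [N], so that truncated sums qualify as F. *)
Lemma sum_tprod (R : realType) (t F : nat -> R) (N : nat) : t 0%N = 0 ->
  (forall m, (m < N)%N -> F m = t m * (1 + F m.+1)) -> F 0%N = 0 ->
  \sum_(0 <= m < N) tprod t m * F m.+1 = tprod t N * (1 + F N) - 1.
Proof.
move=> t0; elim: N => [|N IHN] FE F0.
  by rewrite big_geq // tprod0 F0; ring.
rewrite big_nat_recr //= IHN //; last by move=> m mN; apply: FE; rewrite ltnW.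
by rewrite tprodS // (FE N) //; ring.
Qed.

(** Summation by parts: with H_m = P_m F_(m+1), the left side is the sum of (m+1) (H_m -
    H_(m+1)). *)
Lemma telescope_tprod (R : realType) (t F : nat -> R) (N : nat) : t 0%N = 0 ->
  \sum_(0 <= m < N) m.+1%:R * (tprod t m * (F m.+1 - (1 + t m) * F m.+2)) =
  \sum_(0 <= m < N) tprod t m * F m.+1 - N%:R * (tprod t N * F N.+1).
Proof.
move=> t0; elim: N => [|N IHN]; first by rewrite !big_geq // mul0r subr0.
by rewrite !big_nat_recr //= IHN tprodS // -natr1; ring.
Qed.

(** * Enumeration of Fibonacci words by weight, and the total mass of M_n *)

Lemma weight_cons (a : letter) (w : fibword) :
  weight (a :: w) = (letter_val a + weight w)%N.
Proof. by rewrite /weight big_cons. Qed.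

Fixpoint fibwords (n : nat) : seq fibword :=
  match n with
  | 0%N => [:: [::]]
  | n'.+1 => map (cons One) (fibwords n') ++
      match n' with 0%N => [::] | n''.+1 => map (cons Two) (fibwords n'') end
  end.

Lemma fibwordsSS (n : nat) :
  fibwords n.+2 = map (cons One) (fibwords n.+1) ++ map (cons Two) (fibwords n).
Proof. by []. Qed.

Lemma nat_ind2 (P : nat -> Prop) :
  P 0%N -> P 1%N -> (forall n, P n -> P n.+1 -> P n.+2) -> forall n, P n.
Proof.
move=> P0 P1 PSS n; suff [] : P n /\ P n.+1 by [].
by elim: n => [|n [Pn Pn1]]; split=> //; exact: PSS.
Qed.

Lemma mem_map_cons (a b : letter) (w : fibword) (s : seq fibword) :
  (a :: w \in map (cons b) s) = (a == b) && (w \in s).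
Proof.
apply/mapP/andP => [[v vs [-> ->]]|[/eqP -> ws]]; first by rewrite eqxx.
by exists w.
Qed.

Lemma mem_fibwords (n : nat) (w : fibword) : (w \in fibwords n) = (weight w == n).
Proof.
elim/nat_ind2: n w => [w|w|n IHn IHn1 w].
- by case: w => [|[] w]; rewrite ?weight_cons ?inE //= /weight big_nil.
- case: w => [|[] w]; rewrite ?weight_cons /= ?mem_map_cons ?inE //.
  + by rewrite /weight big_nil.
  + case: w => [|[] w]; rewrite ?weight_cons //.
    by rewrite /weight big_nil.
rewrite fibwordsSS mem_cat; case: w => [|a w].
  rewrite /weight big_nil; apply/negbTE/norP.
  by split; apply/negP => /mapP[].
rewrite !mem_map_cons weight_cons IHn IHn1.
by case: a; rewrite /= ?orbF.
Qed.

Lemma uniq_fibwords (n : nat) : uniq (fibwords n).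
Proof.
have consI a : injective (cons a : fibword -> fibword) by move=> v w [].
elim/nat_ind2: n => // n Un Un1.
rewrite fibwordsSS cat_uniq !map_inj_uniq // Un Un1 /= andbT.
apply/hasPn => _ /mapP[w _ ->].
by rewrite mem_map_cons.
Qed.

(* A word 1^k w with w of weight n is either 1^(n+k) or 1^(k+n-m-2) 2 v with v of weight m. *)
Lemma sum_fibwords_aux (R : realType) (x y : nat -> R) (n k : nat) :
  \sum_(w <- fibwords n) (fdim w)%:R * clone_schur_aux x y k w =
  Adet x y (n + k) +
  \sum_(0 <= m < n.-1) m.+1%:R * Bdet x y (k + n - m.+2) m *
    \sum_(w <- fibwords m) (fdim w)%:R * clone_schur x y w.
Proof.
elim/nat_ind2: n k => [k|k|n IHn IHn1 k].
- by rewrite big_seq1 big_geq //= mul1r addr0.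
- by rewrite big_seq1 big_geq //= mul1r addr0.
rewrite fibwordsSS big_cat !big_map /= IHn1 -addrA; congr (_ + _).
  by rewrite addnS.
(* Words that begin with [Two] supply the top term [m = n]; a leading [One] only moves into the
   counter [k]. *)
have -> : \sum_(w <- fibwords n) ((weight w).+1 * fdim w)%:R *
    (Bdet x y k (weight w) * clone_schur_aux x y 0 w) =
    n.+1%:R * Bdet x y k n * \sum_(w <- fibwords n) (fdim w)%:R * clone_schur x y w.
  rewrite mulr_sumr big_seq [RHS]big_seq; apply: eq_bigr => w.
  by rewrite mem_fibwords => /eqP ->; rewrite natrM /clone_schur; ring.
rewrite [in RHS]big_nat_recr //=; congr (_ + _ * Bdet _ _ _ _ * _); last by lia.
by apply: eq_bigr => m _; rewrite addSnnS.
Qed.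

Lemma prodM_xseq (R : realType) (t c : nat -> R) (n : nat) : t 0%N = 0 ->
  \prod_(1 <= k < n.+1) xseq t c k = \prod_(1 <= k < n.+1) c k * tprod t n.
Proof.
move=> t0; elim: n => [|n IHn]; first by rewrite !big_geq // tprod0 mulr1.
by rewrite big_nat_recr //= IHn [in RHS]big_nat_recr //= tprodS // /xseq /=; ring.
Qed.

Lemma sum_fibwords_clone (R : realType) (t c : nat -> R) (n : nat) : t 0%N = 0 ->
  \sum_(w <- fibwords n) (fdim w)%:R * clone_schur (xseq t c) (yseq t c) w =
  \prod_(1 <= k < n.+1) xseq t c k.
Proof.
move=> t0; have [N] := ubnP n; elim: N n => // N IHN n nN.
rewrite /clone_schur sum_fibwords_aux addn0 Adet_xyseq // prodM_xseq //.
case: n nN => [|n] nN; first by rewrite !big_geq // tprod0 addr0 mulr1.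
(* This is t_m + ... + t_m ... t_n, which is 0 at m = n+1, and at m = 0 because t_0 = 0. *)
pose F m := series (Ainf_term t m) (n.+1 - m)%N.
have FE m : (m <= n)%N -> F m = t m * (1 + F m.+1).
  by move=> mn; rewrite /F subSn // subSS series_Ainf_termS.
(* Here F_n = t_n and F_(n+1) = 0, so the boundary terms of the telescoped sum reduce to P_n (1 +
   t_n) - 1 = P_(n+1) - 1. *)
have -> : tprod t n.+1 = 1 + \sum_(0 <= m < n)
    m.+1%:R * (tprod t m * (F m.+1 - (1 + t m) * F m.+2)).
  rewrite telescope_tprod // sum_tprod //; last 2 first.
  - by move=> m mn; apply: FE; rewrite ltnW.
  - by rewrite FE // t0 mul0r.
  have FS : F n.+1 = 0 by rewrite /F subnn /series /= big_geq.
  by rewrite FE // FS tprodS //; ring.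
rewrite mulrDr mulr1 [in RHS]mulr_sumr; congr (_ + _).
apply: eq_big_nat => m /= mn.
rewrite IHN; last by lia.
rewrite prodM_xseq // Bdet_xyseq.
have -> : Btrunc t m (0 + n.+1 - m.+2) = F m.+1 - (1 + t m) * F m.+2.
  by rewrite /Btrunc /F add0n !subSS -subSn // subSS.
have -> : (m + (0 + n.+1 - m.+2) + 3 = n.+2)%N by lia.
(* The factors c_1 ... c_m come from the words of weight [m], the remaining ones from B. *)
rewrite [\prod_(1 <= k < n.+2) c k](@big_cat_nat _ _ _ m.+1) //=; [ring | lia].
Qed.

(** * Positivity, and explicit values of the measures *)

Section Positive.
Variables (R : realType) (t c : nat -> R).
Hypothesis t_convergent : convergent_type t.
Hypothesis c_gt0 : forall k : nat, (1 <= k)%N -> 0 < c k.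

Let t0 : t 0%N = 0. Proof. by case: t_convergent. Qed.

Let t_ge0 m : 0 <= t m.
Proof. by case: m => [|m]; [rewrite t0 | case: t_convergent => _ /(_ m.+1 isT)/ltW]. Qed.

Let Asum_cvg m : cvgn (series (Ainf_term t m)).
Proof. by case: t_convergent. Qed.

Lemma Ainf_term_ge0 m r : 0 <= Ainf_term t m r.
Proof. exact: prodr_ge0. Qed.

Lemma limn_Ainf_termS m : limn (series (Ainf_term t m)) =
  t m * (1 + limn (series (Ainf_term t m.+1))).
Proof.
apply: cvg_lim => //; rewrite -cvg_shiftS.
under eq_fun do rewrite series_Ainf_termS.
by apply: cvgMl_tmp; apply: cvgD; [exact: cvg_cst | exact: Asum_cvg].
Qed.

Lemma BinfE m : Binf t m = limn (series (Ainf_term t m.+1)) -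
  (1 + t m) * limn (series (Ainf_term t m.+2)).
Proof.
rewrite /Binf /Ainf addn3 (limn_Ainf_termS m.+1) (limn_Ainf_termS m.+2); ring.
Qed.

Lemma cvg_Btrunc m : Btrunc t m @ \oo --> Binf t m.
Proof.
rewrite BinfE; apply: cvgB; first by rewrite cvg_shiftS; exact: Asum_cvg.
by apply: cvgMl_tmp; exact: Asum_cvg.
Qed.

(** All increments in [k] have the sign of t_(m+1) - t_m - 1, so the sequence is monotone: it stays
    above its first term t_(m+1) if nondecreasing, and above its limit [Binf t m] if
    nonincreasing. *)
Lemma Btrunc_ge0 m k : 0 <= Btrunc t m k.
Proof.
have [_ _ _ /(_ m) Binf0] := t_convergent.
have Bc : cvgn (Btrunc t m) by apply/cvg_ex; exists (Binf t m); exact: cvg_Btrunc.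
have [d_ge0|d_lt0] := leP 0 (t m.+1 - t m - 1).
  have B0 : Btrunc t m 0 = t m.+1.
    by rewrite /Btrunc /series /= big_nat1 big_geq // Ainf_term0 mulr0 subr0.
  suff /(_ _ _ (leq0n k)) : nondecreasing_seq (Btrunc t m).
    by rewrite B0; apply: le_trans.
  by apply/nondecreasing_seqP => n; rewrite -subr_ge0 BtruncS mulr_ge0 // Ainf_term_ge0.
have Bni : nonincreasing_seq (Btrunc t m).
  apply/nonincreasing_seqP => n; rewrite -subr_le0 BtruncS.
  by rewrite nmulr_rle0 // Ainf_term_ge0.
have := nonincreasing_cvgn_ge Bni Bc k.
by rewrite (cvg_lim _ (@cvg_Btrunc m)) //; apply: le_trans.
Qed.

Let c_ge0 m n : 0 <= \prod_(m.+1 <= i < n) c i.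
Proof.
rewrite big_nat; apply: prodr_ge0 => i /andP[mi _].
by apply/ltW/c_gt0; apply: leq_trans mi.
Qed.

Lemma clone_schur_aux_ge0 k w : 0 <= clone_schur_aux (xseq t c) (yseq t c) k w.
Proof.
elim: w k => [|[] w IHw] k //=; first by rewrite Adet_xyseq.
by rewrite mulr_ge0 // Bdet_xyseq mulr_ge0 // Btrunc_ge0.
Qed.

Lemma prod_xseq_gt0 n : 0 < \prod_(1 <= k < n.+1) xseq t c k.
Proof.
rewrite big_nat; apply: prodr_gt0 => k /andP[k1 _].
by rewrite mulr_gt0 // ?c_gt0 // ltr_pwDl.
Qed.

Lemma clone_measure_ge0 n w : 0 <= clone_measure (xseq t c) (yseq t c) n w.
Proof.
by rewrite divr_ge0 ?mulr_ge0 ?clone_schur_aux_ge0 // ltW // prod_xseq_gt0.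
Qed.

Lemma sum_clone_measure n :
  \sum_(w <- fibwords n) clone_measure (xseq t c) (yseq t c) n w = 1.
Proof.
rewrite -mulr_suml sum_fibwords_clone // divff //.
by rewrite gt_eqF // prod_xseq_gt0.
Qed.

Lemma tprod_ge1 m : 1 <= tprod t m.
Proof.
elim: m => [|m IHm]; first by rewrite tprod0.
by rewrite tprodS // mulr_ege1 // lerDl.
Qed.

Lemma clone_schur_aux_nseq (x y : nat -> R) k n w :
  clone_schur_aux x y k (nseq n One ++ w) = clone_schur_aux x y (k + n) w.
Proof. by elim: n k => [|n IHn] k; rewrite ?addn0 //= IHn addnS addSn. Qed.

Lemma fdim_nseq n w : fdim (nseq n One ++ w) = fdim w.
Proof. by elim: n. Qed.

Lemma clone_measure_nseq n :
  clone_measure (xseq t c) (yseq t c) n (nseq n One) = (tprod t n)^-1.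
Proof.
rewrite /clone_measure /clone_schur -[nseq n One]cats0 fdim_nseq.
rewrite clone_schur_aux_nseq /= mul1r add0n Adet_xyseq //.
have /lt0r_neq0 := prod_xseq_gt0 n.
rewrite prodM_xseq // mulf_eq0 negb_or => /andP[c0 p0].
by rewrite invfM mulrA divff // mul1r.
Qed.

(** The factors c_i cancel, and the dependence on [n] is confined to the last quotient, whose limit
    is immediate. *)
Lemma clone_measure_nseq_two n u :
  clone_measure (xseq t c) (yseq t c) (n + weight u + 2) (nseq n One ++ Two :: u) =
  tprod t (weight u) * (weight u).+1%:R *
    clone_measure (xseq t c) (yseq t c) (weight u) u *
    (Btrunc t (weight u) n / tprod t (n + weight u + 2)).
Proof.
rewrite /clone_measure /clone_schur fdim_nseq clone_schur_aux_nseq /= add0n natrM.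
rewrite Bdet_xyseq.
have /lt0r_neq0 := prod_xseq_gt0 (n + weight u + 2).
have /lt0r_neq0 := prod_xseq_gt0 (weight u).
rewrite !prodM_xseq // (@big_cat_nat _ _ _ (weight u).+1 1 (n + weight u + 2).+1) //=; last by lia.
have -> : (weight u + n + 3 = (n + weight u + 2).+1)%N by lia.
rewrite !mulf_eq0 !negb_or => /andP[c0 p0] /andP[/andP[_ c0'] p0'].
by field; rewrite c0 p0 c0' p0'.
Qed.

End Positive.

(** * Monotone summable sequences *)

Lemma cvg_half : half n @[n --> \oo] --> \oo.
Proof.
apply/cvgnyPge => A; near=> n.
have : (A.*2 <= n)%N by near: n; exact: nbhs_infty_ge.
lia.
Unshelve. all: by end_near. Qed.

(** Olivier's theorem: at least n/2 indices lie in [n/2, n), and each has H_k >= H_n, so n H_n is at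
    most twice that block of the series, which tends to 0. *)
Lemma nonincreasing_cvg_series_mulrn (R : realType) (H : nat -> R) :
  nonincreasing_seq H -> (forall n, 0 <= H n) -> cvgn (series H) ->
  n%:R * H n @[n --> \oo] --> 0.
Proof.
move=> Hni H0 Hc.
have lim0 : 2 * (series H n - series H n./2) @[n --> \oo] --> (0 : R).
  rewrite -(mulr0 2) -(subrr (limn (series H))).
  apply: cvgMl_tmp; apply: cvgB => //.
  exact: (cvg_comp _ _ cvg_half Hc).
apply: (squeeze_cvgr _ (cvg_cst 0) lim0); near=> n.
rewrite mulr_ge0 //=.
have n2 : (n./2 <= n)%N by lia.
rewrite sub_series_geq // -(@ler_pM2l _ 2^-1) // mulKf //.
have : \sum_(n./2 <= k < n) H n <= \sum_(n./2 <= k < n) H k.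
  by rewrite !big_nat; apply: ler_sum => k /andP[_ kn]; apply/Hni/ltnW.
apply: le_trans; rewrite sumr_const_nat -[leRHS]mulr_natl mulrA.
rewrite ler_wpM2r // ler_pdivrMl // -natrM ler_nat; lia.
Unshelve. all: by end_near. Qed.

(** * The limit of the telescoped sum *)

Section Limit.
Variables (R : realType) (t : nat -> R).
Hypothesis t_convergent : convergent_type t.
Hypothesis prod_cvg : cvgn (partial_prod (fun i => 1 + t i)).

Let t0 : t 0%N = 0. Proof. by case: t_convergent. Qed.

Let F m := limn (series (Ainf_term t m)).

Let FE m : F m = t m * (1 + F m.+1). Proof. exact: limn_Ainf_termS. Qed.

Let tprod_gt0 m : 0 < tprod t m.
Proof. exact: lt_le_trans (tprod_ge1 t_convergent m). Qed.

Lemma cvg_tprod : tprod t @ \oo --> infprod (fun i => 1 + t i).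
Proof. by rewrite -cvg_shiftS; exact: prod_cvg. Qed.

Lemma infprod_gt0 : 0 < infprod (fun i => 1 + t i).
Proof.
apply: (@lt_le_trans _ _ 1) => //.
rewrite -(cvg_lim _ cvg_tprod) //; apply: limr_ge.
  by apply/cvg_ex; eexists; exact: cvg_tprod.
by apply: nearW => n; exact: tprod_ge1.
Qed.

Let H m := tprod t m * F m.+1.

Let F_ge0 m : 0 <= F m.
Proof.
apply: limr_ge; first by case: t_convergent.
by apply: nearW => n; apply: sumr_ge0 => i _; exact: Ainf_term_ge0.
Qed.

Let H_ge0 m : 0 <= H m.
Proof. by rewrite mulr_ge0 // ltW. Qed.

Let HB m : H m - H m.+1 = tprod t m * Binf t m.
Proof. by rewrite /H (BinfE t_convergent) tprodS // -/(F _) -/(F _); ring. Qed.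

Let H_ni : nonincreasing_seq H.
Proof.
apply/nonincreasing_seqP => n; rewrite -subr_ge0 HB.
by apply: mulr_ge0; [exact/ltW | case: t_convergent].
Qed.

Let tprod_neq0 m : tprod t m != 0. Proof. exact: lt0r_neq0. Qed.

(* [H] converges, being monotone, hence so does [F = H / tprod]; as [t] tends
   to 0, the recursion for [F] forces its limit to be 0. *)
Lemma cvg_limn_Ainf_term : F @ \oo --> 0.
Proof.
have P0 := lt0r_neq0 infprod_gt0.
have Hc : cvgn H.
  by apply: nonincreasing_is_cvgn => //; exists 0 => _ [n _ <-]; exact: H_ge0.
have Fc : F n.+1 @[n --> \oo] --> limn H * (infprod (fun i => 1 + t i))^-1.
  have -> : (fun n => F n.+1) = (fun n => H n * (tprod t n)^-1).
    by apply/funext => n; rewrite /H mulrAC divff ?mul1r.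
  by apply: cvgM => //; apply: cvgV => //; exact: cvg_tprod.
have tc : t n @[n --> \oo] --> 0.
  have -> : t = (fun n => tprod t n.+1 * (tprod t n)^-1 - 1).
    by apply/funext => n; rewrite tprodS // mulfK //; ring.
  rewrite -[0](subrr 1); apply: cvgB; last exact: cvg_cst.
  rewrite -(divff P0); apply: cvgM; first by rewrite cvg_shiftS; exact: cvg_tprod.
  by apply: cvgV => //; exact: cvg_tprod.
have -> : F = (fun n => t n * (1 + F n.+1)) by apply/funext => n; rewrite -FE.
rewrite -(mul0r (1 + limn H * (infprod (fun i => 1 + t i))^-1)).
by apply: cvgM => //; apply: cvgD => //; exact: cvg_cst.
Qed.

(** As M_m has mass 1, the m-th term divided by the infinite product is the mass of all 1^oo 2 u
    with |u| = m. *)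
Lemma cvg_series_tprod_Binf :
  series (fun m => m.+1%:R * (tprod t m * Binf t m)) @ \oo -->
  infprod (fun i => 1 + t i) - 1.
Proof.
have F0 : F 0%N = 0 by rewrite FE t0 mul0r.
have Hs : series H = (fun n => tprod t n * (1 + F n) - 1).
  by apply/funext => n; rewrite /series /= sum_tprod.
have Hc : series H @ \oo --> infprod (fun i => 1 + t i) - 1.
  rewrite Hs -[X in X - 1]mulr1; apply: cvgB; last exact: cvg_cst.
  apply: cvgM; first exact: cvg_tprod.
  rewrite -[X in _ --> X]addr0; apply: cvgD; first exact: cvg_cst.
  exact: cvg_limn_Ainf_term.
have -> : series (fun m => m.+1%:R * (tprod t m * Binf t m)) =
    (fun n => series H n - n%:R * H n).
  apply/funext => n; rewrite /series /= -telescope_tprod //.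
  by apply: eq_bigr => m _; rewrite BinfE.
(* The boundary term n H_n vanishes in the limit, since [H] is nonincreasing and summable. *)
rewrite -[X in _ --> X]subr0; apply: cvgB => //.
apply: nonincreasing_cvg_series_mulrn => //.
by apply/cvg_ex; eexists; exact: Hc.
Qed.

End Limit.

(** * Regrouping by weight, and the limit law *)

(** The finite lists [fibwords n] partition all words, and nonnegative terms may be regrouped. *)
Lemma esum_fibword (R : realType) (f : fibword -> \bar R) :
  (forall w, 0 <= f w)%E ->
  (\esum_(w in [set: fibword]) f w =
   \sum_(0 <= n <oo) \sum_(w <- fibwords n) f w)%E.
Proof.
move=> f0.
have -> : [set: fibword] = \bigcup_n [set` fibwords n].
  apply/seteqP; split=> w // _; exists (weight w) => //=.
  by rewrite mem_fibwords.
rewrite nneseries_sum_bigcup //; last first.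
  move=> m n _ _ [w []] /=; rewrite !mem_fibwords => /eqP <- /eqP //.
congr (limn _); apply/funext => N; apply: eq_bigr => n _.
rewrite esum_fset; [|exact: finite_seq|by move=> *; exact: f0].
by rewrite -fsbig_seq; [|exact: uniq_fibwords].
Qed.

Theorem theorem1p5 (R : realType) (t c : nat -> R)
  (t_convergent : convergent_type t)
  (prod_cvg : cvgn (partial_prod (fun i => 1 + t i)))
  (prod_neq0 : infprod (fun i => 1 + t i) != 0)
  (c_gt0 : forall k : nat, (1 <= k)%N -> 0 < c k) :
  let x := xseq t c in
  let y := yseq t c in
  let M := clone_measure x y in
  let mu := muI t x y in
  [/\ (fun n : nat => M n (nseq n One)) @ \oo --> mu OneInf,
      forall u : fibword,
        (fun n : nat => M (n + weight u + 2)%N (nseq n One ++ Two :: u)) @ \oo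
          --> mu (OneInfTwo u),
      forall z : infword, 0 <= mu z
    & ((mu OneInf)%:E + \esum_(u in [set: fibword]) (mu (OneInfTwo u))%:E = 1)%E].
Proof.
move=> x y M mu.
set P := infprod (fun i => 1 + t i) in prod_neq0.
have P_cvg : tprod t @ \oo --> P by exact: cvg_tprod.
have P_gt0 : 0 < P by exact: infprod_gt0.
have t0 : t 0%N = 0 by case: t_convergent.
have mu1 : mu OneInf = P^-1.
  rewrite /mu /= /infprod; apply: cvg_lim => //.
  have -> : partial_prod (fun i => (1 + t i)^-1) = (fun n => (tprod t n.+1)^-1).
    by apply/funext => n; rewrite /partial_prod /tprod prodfV.
  by apply: cvgV => //; rewrite cvg_shiftS.
have muE u : mu (OneInfTwo u) = tprod t (weight u) * (weight u).+1%:R *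
    M (weight u) u * (Binf t (weight u) / P) by [].
have mu_ge0 u : 0 <= mu (OneInfTwo u).
  have [_ _ _ Binf_ge0] := t_convergent.
  rewrite muE mulr_ge0 ?divr_ge0 // ?(ltW P_gt0) //.
  rewrite mulr_ge0 ?clone_measure_ge0 // mulr_ge0 //.
  by rewrite (le_trans ler01) // tprod_ge1.
split.
- rewrite mu1; under eq_fun do rewrite /M clone_measure_nseq //.
  exact: cvgV.
- move=> u; rewrite muE; under eq_fun do rewrite /M clone_measure_nseq_two //.
  (* Only b_n(|u|) and P_(n+|u|+2) vary with [n]; the latter is a shift of a convergent sequence. *)
  apply: cvgMl_tmp; apply: cvgM; first exact: cvg_Btrunc.
  apply: cvgV => //; under eq_fun do rewrite -addnA.
  exact: (cvg_comp _ _ (cvg_addnr _) P_cvg).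
- by case=> [|u]; [rewrite mu1 invr_ge0 ltW | exact: mu_ge0].
rewrite mu1 esum_fibword; last by move=> w; rewrite lee_fin.
have -> : (\sum_(0 <= n <oo) \sum_(w <- fibwords n) (mu (OneInfTwo w))%:E = (1 - P^-1)%:E)%E.
  have -> : 1 - P^-1 = (P - 1) * P^-1 by rewrite mulrBl divff // mul1r.
  apply: cvg_lim => //.
  have -> : (fun N => \sum_(0 <= n < N) \sum_(w <- fibwords n) (mu (OneInfTwo w))%:E)%E =
    EFin \o (fun N => series (fun m => m.+1%:R * (tprod t m * Binf t m)) N * P^-1).
    apply/funext => N; rewrite [RHS]/comp /series mulr_suml -sumEFin; apply: eq_bigr => n _.
    rewrite sumEFin; congr EFin.
    (* Words of equal weight differ only in the factor [M n w], and these factors sum to 1. *)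
    transitivity (\sum_(w <- fibwords n)
        n.+1%:R * (tprod t n * Binf t n) / P * M n w).
      rewrite big_seq [RHS]big_seq; apply: eq_bigr => w.
      by rewrite mem_fibwords muE => /eqP ->; ring.
    by rewrite -mulr_sumr sum_clone_measure // mulr1.
  apply: cvg_EFin; first exact: nearW.
  by apply: cvgMr_tmp; exact: cvg_series_tprod_Binf.
by rewrite -EFinD; congr EFin; ring.
Qed.
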